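(* Let $V:\Omega\to[1,\infty)$ be measurable and let $S$ be a stochastic operator on $\mathcal M_V$. Assume: (i) (operator Lyapunov condition) there exist $0<\gamma_L<1$ and $K\ge0$ such that $\|S\mu\|_V\le\gamma_L\|\mu\|_V+K\|\mu\|$ for all $\mu\in\mathcal M_V$; (ii) (local coupling condition) there exist $0<\gamma_H<1$ and $A>0$ such that for every $\nu\in\mathcal N_V$ with $\|\nu\|_V\le A\|\nu\|$ one has $\|S\nu\|\le\gamma_H\|\nu\|$; (iii) $K/A<1-\gamma_L$. Then $S$ has a unique equilibrium $\mu^*\in\mathcal P_V$, and there exist $\gamma\in(0,1)$ and $C\in[1,\infty)$ such that $$\|S^n\nu\|_V\le C\gamma^n\|\nu\|_V\qquad\text{for all }\nu\in\mathcal N_V\text{ and }n\in\mathbb N .$$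
   Context: Let $(\Omega,\mathcal E)$ be a measurable space. $\mathcal M$ denotes the space of finite signed measures on $\Omega$, $\mathcal P\subset\mathcal M$ the set of probability measures, and $\mathcal N=\{\nu\in\mathcal M:\nu(\Omega)=0\}$. For $\mu\in\mathcal M$ with Hahn–Jordan decomposition $\mu=\mu_+-\mu_-$, $|\mu|=\mu_++\mu_-$ and $\|\mu\|=\int_\Omega d|\mu|$ is the total variation norm. For a measurable $V:\Omega\to[1,\infty)$, $\|\mu\|_V=\int_\Omega V\,d|\mu|$, $\mathcal M_V=\{\mu\in\mathcal M:\|\mu\|_V<\infty\}$, $\mathcal P_V=\mathcal P\cap\mathcal M_V$, $\mathcal N_V=\mathcal N\cap\mathcal M_V$. A stochastic operator is a linear map $S:\mathcal M\to\mathcal M$ with $S(\mathcal P)\subseteq\mathcal P$; it is a stochastic operator on $\mathcal M_V$ if moreover $S(\mathcal M_V)\subseteq\mathcal M_V$ and the restriction is bounded for $\|\cdot\|_V$. An equilibrium of $S$ is a $\mu\in\mathcal P$ with $S\mu=\mu$. *)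

(* Defs.v *)
From HB Require Import structures.
From mathcomp Require Import all_boot all_order all_algebra.
From mathcomp Require Import all_classical all_reals all_analysis.
Set Implicit Arguments. Unset Strict Implicit. Unset Printing Implicit Defensive.
Import Order.TTheory GRing.Theory Num.Theory.
Import numFieldNormedType.Exports.
Local Open Scope classical_set_scope.
Local Open Scope ring_scope.

(* Finite signed measures on a measurable space T are the charges
   {charge set T -> \bar R} of MathComp-Analysis (finite-valued,
   sigma-additive set functions).  Two charges are identified when they
   agree on measurable sets. *)

Section TV.
Context d (T : measurableType d) (R : realType).

Lemma hahn_exists (nu : {charge set T -> \bar R}) :
  exists PN : set T * set T, hahn_decomposition nu PN.1 PN.2.
Proof.
have [P [N h]] := Hahn_decomposition nu.
by exists (P, N).
Qed.

Definition hahn_of (nu : {charge set T -> \bar R}) :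
  {PN : set T * set T | hahn_decomposition nu PN.1 PN.2} :=
  cid (hahn_exists nu).

Definition tvar (nu : {charge set T -> \bar R}) :=
  charge_variation (projT2 (hahn_of nu)).

Definition tvnorm (nu : {charge set T -> \bar R}) : \bar R := tvar nu setT.

Definition Vnorm (V : T -> R) (nu : {charge set T -> \bar R}) : \bar R :=
  (\int[tvar nu]_x (V x)%:E)%E.

Definition in_MV (V : T -> R) (nu : {charge set T -> \bar R}) : Prop :=
  (Vnorm V nu < +oo)%E.

Definition in_N (nu : {charge set T -> \bar R}) : Prop := nu setT = 0%E.

Definition is_prob (mu : {charge set T -> \bar R}) : Prop :=
  (forall A, measurable A -> (0 <= mu A)%E) /\ mu setT = 1%E.

Definition linear_op
  (S : {charge set T -> \bar R} -> {charge set T -> \bar R}) : Prop :=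
  (forall mu nu A, measurable A -> S (cadd mu nu) A = (S mu A + S nu A)%E) /\
  (forall (r : R) mu A, measurable A -> S (cscale r mu) A = (r%:E * S mu A)%E).

Definition stochastic_op
  (S : {charge set T -> \bar R} -> {charge set T -> \bar R}) : Prop :=
  linear_op S /\ (forall mu, is_prob mu -> is_prob (S mu)).

Definition stochastic_op_V (V : T -> R)
  (S : {charge set T -> \bar R} -> {charge set T -> \bar R}) : Prop :=
  stochastic_op S /\
  (forall mu, in_MV V mu -> in_MV V (S mu)) /\
  (exists c : R, forall mu, in_MV V mu -> (Vnorm V (S mu) <= c%:E * Vnorm V mu)%E).

Definition equilibrium
  (S : {charge set T -> \bar R} -> {charge set T -> \bar R})
  (mu : {charge set T -> \bar R}) : Prop :=
  is_prob mu /\ (forall A, measurable A -> S mu A = mu A).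

End TV.

(* Main.v *)
Require Import Defs.
From HB Require Import structures.
From mathcomp Require Import all_boot all_order all_algebra.
From mathcomp Require Import all_classical all_reals all_analysis.
From mathcomp Require Import measurable_realfun ring lra.
Set Implicit Arguments.
Unset Strict Implicit.
Unset Printing Implicit Defensive.
Import Order.TTheory GRing.Theory Num.Theory.
Import numFieldNormedType.Exports.
Local Open Scope classical_set_scope.
Local Open Scope ring_scope.

(** On [N_V] the operator contracts [tvnorm nu + b * Vnorm V nu] for a small
    [b > 0]: when [Vnorm V nu <= A * tvnorm nu] the coupling condition makes the
    first term drop by the factor [gammaH], which absorbs the Lyapunov error
    [b * K * tvnorm nu]; otherwise that error is at most [b * (K / A) * Vnorm V nu]
    and [gammaL + K / A < 1] makes the second term drop.  This gives the
    geometric decay and uniqueness; the equilibrium is the limit of the orbit of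
    a Dirac mass, as charges of finite V-norm form a complete space. *)

(** * Total variation and weighted norms of charges *)

Section total_variation.
Context d (T : measurableType d) (R : realType).
Local Open Scope ereal_scope.
Implicit Types (mu nu rho : {charge set T -> \bar R}) (V : T -> R).

Definition csub mu nu : {charge set T -> \bar R} := cadd mu (cscale (-1) nu).

Lemma csubE mu nu B : csub mu nu B = mu B - nu B.
Proof.
transitivity (mu B + (- 1%R)%:E * nu B); first by [].
by rewrite EFinN mulN1e.
Qed.

(** The set function [tvar nu] retyped as a measure, so that results on integrals and measures apply
    to it. *)
Definition tvarm nu : {measure set T -> \bar R} :=
  charge_variation (projT2 (hahn_of nu)).

Lemma tvar_fin_num nu B : measurable B -> tvar nu B \is a fin_num.
Proof. by move=> mB; rewrite /tvar fin_num_measure. Qed.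

Lemma abse_le_tvar nu B : measurable B -> `|nu B| <= tvar nu B.
Proof. by move=> mB; exact: abse_charge_variation. Qed.

(** On a Hahn decomposition [P], [N] the variation of [B] is [nu (B]&[P) - nu (B]&[N)], so the bound
    is needed only on these two pieces. Asking only additivity of [m] lets it be a measure or a
    charge. *)
Lemma tvar_le_additive nu (m : set T -> \bar R) : additive2 m ->
  (forall B, measurable B -> `|nu B| <= m B) ->
  forall B, measurable B -> tvar nu B <= m B.
Proof.
move=> madd num B mB; rewrite /tvar /charge_variation.
case: (hahn_of nu) => -[P N] /= nuPN.
have [[mP _] [mN _] PNT PN0] := nuPN.
rewrite jordan_posE cjordan_posE jordan_negE cjordan_negE.
rewrite /crestr0 mem_set// /crestr.
have mBP : measurable (B `&` P) by exact: measurableI.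
have mBN : measurable (B `&` N) by exact: measurableI.
have -> : m B = m (B `&` P) + m (B `&` N).
  rewrite -[in LHS](setIT B) -PNT setIUr; apply: madd => //.
  by rewrite setIACA PN0 setI0.
apply: leeD; first exact: le_trans (lee_abs _) (num _ mBP).
by apply: le_trans (num _ mBN); rewrite -abseN; exact: lee_abs.
Qed.

Lemma measure_additive2 (m : {measure set T -> \bar R}) : additive2 m.
Proof. by move=> A B mA mB AB; rewrite measureU. Qed.

Lemma charge_jordan nu : exists p n : {finite_measure set T -> \bar R},
  (forall B, measurable B -> nu B = p B - n B) /\
  (forall B, tvar nu B = p B + n B).
Proof.
exists (jordan_pos (projT2 (hahn_of nu))), (jordan_neg (projT2 (hahn_of nu))).
split=> // B mB.
by rewrite (jordan_decomp (projT2 (hahn_of nu)) mB) /cadd /= cscaleN1.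
Qed.

Section weighted.
Variable V : T -> R.
Hypotheses (mV : measurable_fun [set: T] V) (V0 : forall x, (0 <= V x)%R).

Let mVE : measurable_fun [set: T] (EFin \o V).
Proof. exact/measurable_EFinP. Qed.

Let VE0 x : 0 <= (V x)%:E. Proof. by rewrite lee_fin. Qed.

Lemma Vnorm_ge0 nu : 0 <= Vnorm V nu.
Proof. exact: (@integral_ge0 _ _ _ (tvarm nu)). Qed.

(** A setwise bound passes to the variation by [tvar_le_additive], then to the integral by
    monotonicity in the measure. The comparisons of V-norms below rest on this. *)
Lemma Vnorm_le_measure nu (m : {measure set T -> \bar R}) :
  (forall B, measurable B -> `|nu B| <= m B) ->
  Vnorm V nu <= \int[m]_x (V x)%:E.
Proof.
move=> num; apply: (@ge0_le_measure_integral _ _ _ (tvarm nu)) => //.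
exact: tvar_le_additive (measure_additive2 _) num.
Qed.

Lemma Vnorm_le_tvar nu mu :
  (forall B, measurable B -> `|nu B| <= tvar mu B) -> Vnorm V nu <= Vnorm V mu.
Proof. exact: (@Vnorm_le_measure nu (tvarm mu)). Qed.

(** The variation comes from a chosen Hahn decomposition, which may differ for [nu] and [mu];
    domination in both directions removes the choice. *)
Lemma eq_Vnorm nu mu :
  (forall B, measurable B -> nu B = mu B) -> Vnorm V nu = Vnorm V mu.
Proof.
move=> numu; apply/eqP; rewrite eq_le; apply/andP; split.
  by apply: Vnorm_le_tvar => B mB; rewrite numu// abse_le_tvar.
by apply: Vnorm_le_tvar => B mB; rewrite -numu// abse_le_tvar.
Qed.

(** The triangle inequality with a setwise hypothesis, so that it serves for sums and differences
    alike: [nu] is dominated by the sum of the two variation measures. *)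
Lemma Vnorm_leD nu mu rho :
  (forall B, measurable B -> `|nu B| <= `|mu B| + `|rho B|) ->
  Vnorm V nu <= Vnorm V mu + Vnorm V rho.
Proof.
move=> H; rewrite /Vnorm.
rewrite -(@ge0_integral_measure_add _ _ _ (tvarm mu) (tvarm rho))//.
apply: Vnorm_le_measure => B mB.
suff : `|nu B| <= measure_add (tvarm mu) (tvarm rho) B by [].
rewrite measure_addE; apply: le_trans (H _ mB) _.
by apply: leeD; exact: abse_le_tvar.
Qed.

Lemma Vnorm_csub mu nu : Vnorm V (csub mu nu) <= Vnorm V mu + Vnorm V nu.
Proof. by apply: Vnorm_leD => B mB; rewrite csubE lee_abs_sub. Qed.

Lemma Vnorm0 nu : (forall B, measurable B -> nu B = 0) -> Vnorm V nu = 0.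
Proof.
move=> nu0; apply/eqP; rewrite eq_le Vnorm_ge0 andbT.
have <- : \int[mzero]_x (V x)%:E = 0 by rewrite integral_measure_zero.
by apply: Vnorm_le_measure => B mB; rewrite nu0// abse0.
Qed.

End weighted.

(** Carries the results on weighted norms over to total variation. *)
Lemma tvnormE nu : tvnorm nu = Vnorm (cst 1%R) nu.
Proof.
by have := @integral_cst _ _ _ (tvarm nu) setT measurableT 1; rewrite mul1e => /esym.
Qed.

Lemma tvnorm_fin_num nu : tvnorm nu \is a fin_num.
Proof. exact: tvar_fin_num. Qed.

Lemma tvnorm_ge0 nu : 0 <= tvnorm nu.
Proof. by rewrite tvnormE Vnorm_ge0. Qed.

Lemma eq_tvnorm nu mu :
  (forall B, measurable B -> nu B = mu B) -> tvnorm nu = tvnorm mu.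
Proof. by move=> numu; rewrite !tvnormE (eq_Vnorm _ _ numu). Qed.

Lemma abse_le_tvnorm nu B : measurable B -> `|nu B| <= tvnorm nu.
Proof.
move=> mB; apply: le_trans (abse_le_tvar _ mB) _.
by apply: (@le_measure _ _ _ (tvarm nu)); rewrite ?inE.
Qed.

(** * Completeness of the charges of finite V-norm *)

Section complete.
Variable V : T -> R.
Hypotheses (mV : measurable_fun [set: T] V) (V1 : forall x, (1 <= V x)%R).

Let V0 x : (0 <= V x)%R. Proof. exact: le_trans ler01 (V1 x). Qed.

Lemma tvnorm_le_Vnorm nu : tvnorm nu <= Vnorm V nu.
Proof.
rewrite tvnormE; apply: (@ge0_le_integral _ _ _ (tvarm nu)) => //.
- exact/measurable_EFinP.
- exact/measurable_EFinP.
- by move=> x _; rewrite lee_fin.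
Qed.

Lemma Vnorm_eq0 nu : Vnorm V nu <= 0 -> forall B, measurable B -> nu B = 0.
Proof.
move=> nu0 B mB; apply/eqP; rewrite -abse_eq0 eq_le abse_ge0 andbT.
exact: le_trans (abse_le_tvnorm _ mB) (le_trans (tvnorm_le_Vnorm _) nu0).
Qed.

(** The bound on the total mass is an argument so that a finite-measure structure can be declared on
    the series, which then yields a charge. *)
Definition finite_mseries (m : {measure set T -> \bar R}^nat)
  (_ : mseries m 0 setT < +oo) : set T -> \bar R := mseries m 0.

HB.instance Definition _ m h := Measure.on (@finite_mseries m h).

Let finite_mseries_fin m h : fin_num_fun (@finite_mseries m h).
Proof. exact: lty_fin_num_fun. Qed.

HB.instance Definition _ m h := @Measure_isFinite.Build _ _ _
  (@finite_mseries m h) (@finite_mseries_fin m h).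

(* The limit is mu_0 plus the difference of the series of the Jordan parts of
   the increments, which are countable sums of measures. *)
Lemma Vnorm_complete (mu : {charge set T -> \bar R}^nat) :
  \sum_(0 <= k <oo) Vnorm V (csub (mu k.+1) (mu k)) < +oo ->
  exists l, forall n, Vnorm V (csub l (mu n)) <=
    \sum_(0 <= k <oo) Vnorm V (csub (mu (n + k).+1) (mu (n + k)%N)).
Proof.
set nu := fun k => csub (mu k.+1) (mu k).
move=> sumV.
have /choice[p] : forall k, exists p : {finite_measure set T -> \bar R},
    exists n : {finite_measure set T -> \bar R},
    (forall B, measurable B -> nu k B = p B - n B) /\
    (forall B, tvar (nu k) B = p B + n B).
  by move=> k; exact: charge_jordan.
move=> /choice[q pq].
(* As [V >= 1], the total masses of the increments are summable, so both series of Jordan parts are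
   finite measures. *)
have sumtv : \sum_(0 <= k <oo) tvnorm (nu k) < +oo.
  apply: le_lt_trans sumV; apply: lee_nneseries => k *; first exact: tvnorm_ge0.
  exact: tvnorm_le_Vnorm.
have hp : mseries (fun k => p k) 0 setT < +oo.
  apply: le_lt_trans sumtv; apply: lee_nneseries => // k _.
  by rewrite /tvnorm (pq k).2 leeDl.
have hq : mseries (fun k => q k) 0 setT < +oo.
  apply: le_lt_trans sumtv; apply: lee_nneseries => // k _.
  by rewrite /tvnorm (pq k).2 leeDr.
pose P : {charge set T -> \bar R} := charge_of_finite_measure (@finite_mseries _ hp).
pose Q : {charge set T -> \bar R} := charge_of_finite_measure (@finite_mseries _ hq).
pose l : {charge set T -> \bar R} := cadd (mu 0%N) (csub P Q).
have lE B : l B = mu 0%N B + (P B - Q B) by rewrite -csubE.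
exists l => n.
(* The right-hand side is the integral of [V] against the sum of the variations of the increments
   from [n] on, so it suffices to dominate [l - mu n] by that measure setwise. *)
pose m := (fun k => tvarm (nu (n + k)%N)).
have -> : \sum_(0 <= k <oo) Vnorm V (csub (mu (n + k).+1) (mu (n + k)%N)) =
    \int[mseries m 0]_x (V x)%:E.
  rewrite ge0_integral_measure_series//; first by move=> t _; rewrite lee_fin.
  exact/measurable_EFinP.
apply: Vnorm_le_measure => // B mB; rewrite csubE lE.
(* Telescoping: [mu n] uses the first [n] terms of both series, so [l - mu n] is the difference of
   their tails, bounded by the sum of the tails. *)
have mun : mu n B = mu 0%N B + (\sum_(0 <= k < n) p k B - \sum_(0 <= k < n) q k B).
  elim: (n) => [|k IH]; first by rewrite !big_geq// sube0 adde0.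
  move: IH ((pq k).1 B mB); rewrite csubE !big_nat_recr//=.
  have fs (r : nat -> {finite_measure set T -> \bar R}) :
      \sum_(0 <= i < k) r i B \is a fin_num.
    by rewrite sum_fin_num; apply/allP => _ /mapP[i _ ->]; exact: fin_num_measure.
  have /EFin_fin_numP[sp ->] := fs p; have /EFin_fin_numP[sq ->] := fs q.
  have /EFin_fin_numP[a ->] := fin_num_measure (mu k.+1) _ mB.
  have /EFin_fin_numP[b ->] := fin_num_measure (mu k) _ mB.
  have /EFin_fin_numP[c ->] := fin_num_measure (mu 0%N) _ mB.
  have /EFin_fin_numP[u ->] := fin_num_measure (p k) _ mB.
  have /EFin_fin_numP[v ->] := fin_num_measure (q k) _ mB.
  by move=> [IH] [H]; congr EFin; lra.
have splitn (r : nat -> {finite_measure set T -> \bar R}) :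
    \sum_(0 <= k <oo) r k B =
    \sum_(0 <= k < n) r k B + \sum_(0 <= k <oo) r (n + k)%N B.
  rewrite (nneseries_split 0 n)// add0n -nneseries_addn//.
  by under eq_eseriesr do rewrite addnC.
have PE : P B = \sum_(0 <= k < n) p k B + \sum_(0 <= k <oo) p (n + k)%N B.
  exact: splitn.
have QE : Q B = \sum_(0 <= k < n) q k B + \sum_(0 <= k <oo) q (n + k)%N B.
  exact: splitn.
suff : `|mu 0%N B + (P B - Q B) - mu n B| <= mseries m 0 B by [].
have -> : mseries m 0 B =
    \sum_(0 <= k <oo) p (n + k)%N B + \sum_(0 <= k <oo) q (n + k)%N B.
  rewrite -nneseriesD//; apply: eq_eseriesr => k _; exact: (pq _).2.
have tp0 : 0 <= \sum_(0 <= k <oo) p (n + k)%N B by exact: nneseries_ge0.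
have tq0 : 0 <= \sum_(0 <= k <oo) q (n + k)%N B by exact: nneseries_ge0.
(* Finiteness of the full sums makes heads and tails finite, which leaves arithmetic in [R]. *)
have fP : P B \is a fin_num by exact: fin_num_measure.
have fQ : Q B \is a fin_num by exact: fin_num_measure.
move: fP fQ tp0 tq0; rewrite PE QE mun !fin_numD.
have /EFin_fin_numP[c ->] := fin_num_measure (mu 0%N) _ mB.
move=> /andP[/EFin_fin_numP[sp ->] /EFin_fin_numP[tp ->]].
move=> /andP[/EFin_fin_numP[sq ->] /EFin_fin_numP[tq ->]].
rewrite !lee_fin => tp0 tq0.
have -> : (c + (sp + tp - (sq + tq)) - (c + (sp - sq)) = tp - tq)%R by ring.
by rewrite ler_norml; apply/andP; split; lra.
Qed.

End complete.
End total_variation.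

(** * Mass and total variation under a stochastic operator *)

Section stochastic_operator.
Context d (T : measurableType d) (R : realType).
Local Open Scope ereal_scope.
Variables (V : T -> R) (S : {charge set T -> \bar R} -> {charge set T -> \bar R}).
Hypotheses (mV : measurable_fun [set: T] V) (V1 : forall x, (1 <= V x)%R).
Hypothesis stochS : stochastic_op_V V S.
Implicit Types mu nu rho : {charge set T -> \bar R}.

Let V0 x : (0 <= V x)%R. Proof. exact: le_trans ler01 (V1 x). Qed.

Lemma stochastic_op_csub mu nu B : measurable B ->
  S (csub mu nu) B = S mu B - S nu B.
Proof.
move=> mB; have [[[addS scaleS] _] _] := stochS.
have H1 : S (csub mu nu) B = S mu B + S (cscale (-1) nu) B by exact: addS.
have H2 : S (cscale (-1) nu) B = (- 1%R)%:E * S nu B by exact: scaleS.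
by rewrite H1 H2 EFinN mulN1e.
Qed.

(* Boundedness for the V-norm makes [S] compatible with the identification of
   charges that agree on measurable sets. *)
Lemma stochastic_op_eq0 nu : (forall B, measurable B -> nu B = 0) ->
  forall B, measurable B -> S nu B = 0.
Proof.
move=> nu0; have [_ [_ [c bndS]]] := stochS.
have Vnu0 : Vnorm V nu = 0 by exact: Vnorm0.
apply: (Vnorm_eq0 mV V1).
by have := bndS nu; rewrite /in_MV Vnu0 mule0; apply; rewrite ltry.
Qed.

Lemma stochastic_op_ext mu nu : (forall B, measurable B -> mu B = nu B) ->
  forall B, measurable B -> S mu B = S nu B.
Proof.
move=> munu B mB.
have /(_ B mB) : forall B, measurable B -> S (csub mu nu) B = 0.
  apply: stochastic_op_eq0 => C mC.
  by rewrite csubE munu// subee// fin_num_measure.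
rewrite stochastic_op_csub//.
have /EFin_fin_numP[a ->] := fin_num_measure (S mu) _ mB.
have /EFin_fin_numP[b ->] := fin_num_measure (S nu) _ mB.
by move=> [/eqP]; rewrite subr_eq0 => /eqP ->.
Qed.

(** A nonnegative charge of positive mass is a multiple of a probability, where the action of [S] is
    known. *)
Lemma stochastic_op_nonneg mu : (forall B, measurable B -> 0 <= mu B) ->
  (forall B, measurable B -> 0 <= S mu B) /\ S mu setT = mu setT.
Proof.
move=> mu0; have [[[_ scaleS] probS] _] := stochS.
have /EFin_fin_numP[m mE] := fin_num_measure mu _ (@measurableT _ T).
have m0 : (0 <= m)%R by rewrite -lee_fin -mE mu0.
(* Zero mass cannot be normalised; but a nonnegative charge dominates its own variation, so here
   [mu] vanishes on measurable sets. *)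
have [mZ|mN0] := eqVneq m 0%R.
  have z B : measurable B -> mu B = 0.
    move=> mB; apply/eqP; rewrite -abse_eq0 eq_le abse_ge0 andbT.
    apply: le_trans (abse_le_tvnorm _ mB) _; rewrite -[leRHS]/(0%R%:E) -mZ -mE.
    apply: (tvar_le_additive (@chargeU _ _ _ mu)) => // C mC.
    by rewrite gee0_abs// mu0.
  have Sz B : measurable B -> S mu B = 0 by exact: stochastic_op_eq0.
  by split=> [B mB|]; rewrite ?Sz ?z.
pose prb : {charge set T -> \bar R} := cscale m^-1 mu.
have prbE B : prb B = m^-1%:E * mu B by [].
have prb_prob : is_prob prb.
  split=> [B mB|]; first by rewrite prbE mule_ge0 ?mu0// lee_fin invr_ge0.
  by rewrite prbE mE -EFinM mulVf.
have SE B : measurable B -> S mu B = m%:E * S prb B.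
  move=> mB; rewrite -scaleS//; apply: stochastic_op_ext => // C mC.
  suff : mu C = m%:E * prb C by [].
  by rewrite prbE muleA -EFinM divff// mul1e.
have [Sprb0 Sprb1] := probS _ prb_prob.
split=> [B mB|]; first by rewrite SE// mule_ge0 ?Sprb0// lee_fin.
by rewrite SE// Sprb1 mule1.
Qed.

Lemma stochastic_op_jordan nu : exists p q : {charge set T -> \bar R},
  [/\ forall B, measurable B -> 0 <= p B,
      forall B, measurable B -> 0 <= q B,
      forall B, measurable B -> nu B = p B - q B,
      tvnorm nu = p setT + q setT
    & forall B, measurable B -> S nu B = S p B - S q B].
Proof.
have [p' [q' [nupq tvpq]]] := charge_jordan nu.
pose p : {charge set T -> \bar R} := charge_of_finite_measure p'.
pose q : {charge set T -> \bar R} := charge_of_finite_measure q'.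
exists p, q; split => //.
- by rewrite /tvnorm tvpq.
- move=> B mB; rewrite -stochastic_op_csub//.
  by apply: stochastic_op_ext => // C mC; rewrite csubE nupq.
Qed.

Lemma stochastic_op_mass nu : S nu setT = nu setT.
Proof.
have [p [q [p0 q0 nupq _ Spq]]] := stochastic_op_jordan nu.
rewrite Spq// nupq//.
by rewrite (stochastic_op_nonneg p0).2 (stochastic_op_nonneg q0).2.
Qed.

(** With Jordan parts [p] and [q], [S nu] is dominated by the nonnegative charge [S p + S q], whose
    mass is that of [p + q]. *)
Lemma tvnorm_stochastic_op nu : tvnorm (S nu) <= tvnorm nu.
Proof.
have [p [q [p0 q0 _ -> Spq]]] := stochastic_op_jordan nu.
have [[Sp0 <-] [Sq0 <-]] := (stochastic_op_nonneg p0, stochastic_op_nonneg q0).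
pose m : {charge set T -> \bar R} := cadd (S p) (S q).
suff : tvar (S nu) setT <= m setT by [].
apply: (tvar_le_additive (@chargeU _ _ _ m)) => // B mB.
have -> : m B = S p B + S q B by [].
rewrite Spq//; apply: le_trans (lee_abs_sub _ _) _.
by rewrite !gee0_abs ?Sp0 ?Sq0.
Qed.

End stochastic_operator.

(** * Contraction constants and geometric bounds in the reals *)

Section real_estimates.
Context (R : realType).

(* x and y stand for the total variation and V-norms of nu, x' and y' for
   those of S nu. *)
Lemma weighted_contraction (gL K gH A : R) :
  0 < gL -> 0 <= K -> 0 < gH < 1 -> 0 < A -> K / A < 1 - gL ->
  exists b g, [/\ 0 < b, 0 < g < 1 & forall x y x' y',
    0 <= x <= y -> x' <= x -> y' <= gL * y + K * x ->
    (y <= A * x -> x' <= gH * x) -> x' + b * y' <= g * (x + b * y)].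
Proof.
move=> gL0 K0 /andP[gH0 gH1] A0 KA.
(* Chosen so that [b * K] is at most half the gap [1 - gH]; the [+ 1] covers [K = 0]. *)
pose b := (1 - gH) / (2 * (K + 1)).
have b0 : 0 < b by rewrite divr_gt0//; lra.
have bK : b * (2 * (K + 1)) = 1 - gH.
  by rewrite /b divfK//; apply/eqP; lra.
set h := gL + K / A.
have KA0 : 0 <= K / A by rewrite divr_ge0// ltW.
have KAA : K / A * A = K by rewrite divfK// gt_eqF.
(* [g1] serves where coupling applies. [g2] solves [1 - g2 = b * (g2 - h)]: in the other case the
   bound is [x + b * h * y], and the excess [(1 - g2) * x] is paid by the gain [b * (g2 - h) * y]
   because [x <= y]. *)
pose g1 := (1 + gH) / 2; pose g2 := (1 + b * h) / (1 + b).
have g2E : g2 * (1 + b) = 1 + b * h by rewrite /g2 divfK//; apply/eqP; lra.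
have h1 : h < 1 by rewrite /h; lra.
have g21 : g2 < 1 by rewrite ltr_pdivrMr ?mul1r; nra.
have g2h : h <= g2 by rewrite ler_pdivlMr; nra.
have bKg1 : gH + b * K <= g1 by rewrite /g1; nra.
exists b, (Num.max g1 g2); set g := Num.max g1 g2.
have gg1 : g1 <= g by rewrite le_max lexx.
have gg2 : g2 <= g by rewrite le_max lexx orbT.
split=> //; first by rewrite lt_max gt_max g21 /g1; apply/andP; split; lra.
move=> x y x' y' /andP[x0 xy] x'x y'y local.
have [yA|/ltW Ay] := leP y (A * x).
  have := local yA => x'H.
  have E1 : b * y' <= b * (gL * y + K * x) by rewrite ler_pM2l.
  have E2 : (gH + b * K) * x <= g * x by rewrite ler_wpM2r//; lra.
  have E3 : gL * (b * y) <= g * (b * y) by rewrite ler_wpM2r//; [nra|rewrite /h in g2h; lra].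
  nra.
have E0 : K * x <= K / A * y by rewrite -{1}KAA -mulrA ler_wpM2l.
have E1 : b * y' <= b * (h * y) by rewrite ler_pM2l// /h; nra.
have E2 : g2 * (x + b * y) <= g * (x + b * y) by rewrite ler_wpM2r//; nra.
have E3 : (1 - g2) * x <= (1 - g2) * y by rewrite ler_wpM2l//; lra.
nra.
Qed.

(** Replaces passages to the limit: the properties of the equilibrium are first obtained up to an
    error geometric in [n]. *)
Lemma le0_le_geometric (D g : R) (x : \bar R) : 0 < g < 1 ->
  (forall n, x <= (D * g ^+ n)%:E)%E -> (x <= 0)%E.
Proof.
move=> /andP[g0 g1] xD; case: x xD => [x| |] xD //; last by have := xD 0%N.
rewrite lee_fin leNgt; apply/negP => x0.
have /cvgrPdist_lt/(_ x x0) : geometric D g n @[n --> \oo] --> 0.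
  by apply: cvg_geometric; rewrite ger0_norm// ltW.
move=> [N _ /(_ N (leqnn N))]; rewrite sub0r normrN /= => H.
have := xD N; rewrite lee_fin leNgt => /negP; apply.
exact: le_lt_trans (ler_norm _) H.
Qed.

Lemma nneseries_le_geometric (u : (\bar R)^nat) (D g : R) :
  0 <= D -> 0 < g < 1 -> (forall n, 0 <= u n)%E ->
  (forall n, u n <= (D * g ^+ n)%:E)%E ->
  (\sum_(0 <= k <oo) u k <= (D / (1 - g))%:E)%E.
Proof.
move=> D0 /andP[g0 g1] u0 uD; apply: lime_le.
  by apply: is_cvg_nneseries => *; exact: u0.
apply: nearW => n.
apply: (@le_trans _ _ (\sum_(0 <= k < n) (D * g ^+ k)%:E)%E).
  by apply: lee_sum => k _; exact: uD.
rewrite sumEFin lee_fin.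
have := @geometric_le_lim R n D g D0 g0; apply.
by rewrite ger0_norm// ltW.
Qed.

End real_estimates.

(** * Geometric decay, uniqueness and existence of the equilibrium *)

Section lyapunov_coupling.
Context d (T : measurableType d) (R : realType).
Variables (V : T -> R) (S : {charge set T -> \bar R} -> {charge set T -> \bar R}).
Variables gammaL K gammaH A : R.
Hypotheses (mV : measurable_fun [set: T] V) (V1 : forall x, 1 <= V x).
Hypothesis stochS : stochastic_op_V V S.
Hypotheses (gammaL01 : 0 < gammaL < 1) (K0 : 0 <= K).
Hypothesis lyapunov : forall mu, in_MV V mu ->
  (Vnorm V (S mu) <= gammaL%:E * Vnorm V mu + K%:E * tvnorm mu)%E.
Hypotheses (gammaH01 : 0 < gammaH < 1) (A0 : 0 < A).
Hypothesis coupling : forall nu, in_N nu -> in_MV V nu ->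
  (Vnorm V nu <= A%:E * tvnorm nu)%E ->
  (tvnorm (S nu) <= gammaH%:E * tvnorm nu)%E.
Hypothesis KA : K / A < 1 - gammaL.
Implicit Types mu nu : {charge set T -> \bar R}.

Let V0 x : 0 <= V x. Proof. exact: le_trans ler01 (V1 x). Qed.

Let stable_MV mu : in_MV V mu -> in_MV V (S mu).
Proof. by case: stochS => _ [+ _]; exact. Qed.

Let stable_N nu : in_N nu -> in_N (S nu).
Proof. by rewrite /in_N (stochastic_op_mass mV V1 stochS). Qed.

Let fin_Vnorm nu : in_MV V nu -> Vnorm V nu \is a fin_num.
Proof. by move=> nuV; rewrite ge0_fin_numE// Vnorm_ge0. Qed.

(** Taken in [R]; [fine] loses nothing on charges of finite V-norm, the only ones to which it is
    applied. *)
Let wnorm (b : R) nu : R := fine (tvnorm nu) + b * fine (Vnorm V nu).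

Lemma wnorm_contraction : exists b g, [/\ 0 < b, 0 < g < 1 &
  forall nu, in_N nu -> in_MV V nu -> wnorm b (S nu) <= g * wnorm b nu].
Proof.
have /andP[gL0 _] := gammaL01.
have [b [g [b0 g01 H]]] := weighted_contraction gL0 K0 gammaH01 A0 KA.
exists b, g; split=> // nu nuN nuV; rewrite /wnorm.
have := tvnorm_stochastic_op mV V1 stochS nu.
have := coupling nuN nuV; have := lyapunov nuV; have := tvnorm_le_Vnorm mV V1 nu.
have := tvnorm_ge0 nu.
have /EFin_fin_numP[x ->] := tvnorm_fin_num nu.
have /EFin_fin_numP[x' ->] := tvnorm_fin_num (S nu).
have /EFin_fin_numP[y ->] := fin_Vnorm nuV.
have /EFin_fin_numP[y' ->] := fin_Vnorm (stable_MV nuV).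
rewrite -!EFinM -EFinD !lee_fin => x0 xy Y X xx'; apply: H => //.
by rewrite x0.
Qed.

(** Since total variation is at most the V-norm, [wnorm b] lies between [b] and [1 + b] times the
    V-norm; the ratio of these factors is [C]. *)
Lemma Vnorm_iter_le : exists g C, [/\ 0 < g < 1, 1 <= C &
  forall nu, in_N nu -> in_MV V nu -> forall n,
    (Vnorm V (iter n S nu) <= (C * g ^+ n)%:E * Vnorm V nu)%E].
Proof.
have [b [g [b0 g01 H]]] := wnorm_contraction.
have /andP[g0 g1] := g01.
exists g, ((1 + b) / b); split=> //; first by rewrite ler_pdivlMr//; lra.
move=> nu nuN nuV n.
have [NVn wn] : (in_N (iter n S nu) /\ in_MV V (iter n S nu)) /\
    wnorm b (iter n S nu) <= g ^+ n * wnorm b nu.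
  elim: n => [|n [[Nn Vn] IH]] /=; first by rewrite expr0 mul1r.
  split; first by split; [exact: stable_N|exact: stable_MV].
  apply: le_trans (H _ Nn Vn) _.
  by rewrite exprS -mulrA ler_pM2l.
move: wn; rewrite /wnorm.
have := tvnorm_ge0 (iter n S nu); have := tvnorm_le_Vnorm mV V1 nu.
have /EFin_fin_numP[x ->] := tvnorm_fin_num nu.
have /EFin_fin_numP[x' ->] := tvnorm_fin_num (iter n S nu).
have /EFin_fin_numP[y ->] := fin_Vnorm nuV.
have /EFin_fin_numP[y' ->] := fin_Vnorm NVn.2.
rewrite -EFinM !lee_fin /= => xy x'0 wn.
have -> : (1 + b) / b * g ^+ n * y = g ^+ n * ((1 + b) * y) / b by ring.
rewrite ler_pdivlMr// [y' * b]mulrC.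
have gn0 : 0 < g ^+ n by rewrite exprn_gt0.
have : g ^+ n * (x + b * y) <= g ^+ n * ((1 + b) * y) by rewrite ler_pM2l//; nra.
lra.
Qed.

(** The difference has zero mass and is fixed by [S], so the contraction forces its [wnorm] to
    vanish. *)
Lemma equilibrium_uniq mu mu' : equilibrium S mu -> equilibrium S mu' ->
  in_MV V mu -> in_MV V mu' -> forall B, measurable B -> mu B = mu' B.
Proof.
move=> [[_ mu1] Smu] [[_ mu'1] Smu'] muV mu'V B mB.
have [b [g [b0 /andP[g0 g1] H]]] := wnorm_contraction.
pose nu := csub mu mu'.
have nuN : in_N nu by rewrite /in_N csubE mu1 mu'1 subee.
have nuV : in_MV V nu.
  by apply: le_lt_trans (Vnorm_csub mV V0 _ _) _; rewrite lte_add_pinfty.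
have Snu C : measurable C -> S nu C = nu C.
  by move=> mC; rewrite (stochastic_op_csub stochS)// Smu// Smu'// csubE.
have := H _ nuN nuV; rewrite /wnorm (eq_tvnorm Snu) (eq_Vnorm mV V0 Snu).
have tv0 := fine_ge0 (tvnorm_ge0 nu).
have Vnu0 := fine_ge0 (Vnorm_ge0 V0 nu).
move=> wle.
have g1' : 0 < 1 - g by rewrite subr_gt0.
have w0 : fine (tvnorm nu) + b * fine (Vnorm V nu) <= 0.
  by rewrite -(pmulr_rle0 _ g1') mulrBl mul1r subr_le0.
have nu0 : (Vnorm V nu <= 0)%E.
  by rewrite -(fineK (fin_Vnorm nuV)) lee_fin -(pmulr_rle0 _ b0); lra.
have := Vnorm_eq0 mV V1 nu0 mB; rewrite csubE.
have /EFin_fin_numP[s ->] := fin_num_measure mu _ mB.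
have /EFin_fin_numP[t ->] := fin_num_measure mu' _ mB.
by move=> [/eqP]; rewrite subr_eq0 => /eqP ->.
Qed.

(** Provides the start of the iteration: the Dirac mass at [point] has V-norm at most [V point], a
    real number. *)
Lemma prob_in_MV_exists : exists mu, is_prob mu /\ in_MV V mu.
Proof.
pose mu : {charge set T -> \bar R} :=
  charge_of_finite_measure (\d_(point : T) : {finite_measure set T -> \bar R}).
have muE B : mu B = \d_(point : T) B by [].
exists mu; split.
  by split=> [B mB|]; rewrite muE// diracT.
rewrite /in_MV.
apply: (@le_lt_trans _ _ (\int[\d_(point : T)]_x (V x)%:E)%E).
  by apply: Vnorm_le_measure => // B mB; rewrite gee0_abs.
rewrite integral_dirac//; first by rewrite diracT mul1e ltry.
exact/measurable_EFinP.
Qed.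

Lemma equilibrium_exists : exists mu, equilibrium S mu /\ in_MV V mu.
Proof.
have /andP[gL0 _] := gammaL01.
have [mu0 [mu0P mu0V]] := prob_in_MV_exists.
have [g [C [g01 C1 H]]] := Vnorm_iter_le.
have [[_ probS] _] := stochS.
pose mu n := iter n S mu0.
have muP n : is_prob (mu n) by elim: n => //= n; exact: probS.
pose nu := csub (S mu0) mu0.
have nuN : in_N nu.
  by rewrite /in_N csubE (muP 1%N).2 mu0P.2 subee.
have nuV : in_MV V nu.
  apply: le_lt_trans (Vnorm_csub mV V0 _ _) _; rewrite lte_add_pinfty//.
  exact: stable_MV.
(* The increments of the orbit are iterates of the first one, which has zero mass, so the geometric
   decay applies to them. Agreement is on measurable sets only, hence the appeal to
   [stochastic_op_ext]. *)
have nuE n B : measurable B -> csub (mu n.+1) (mu n) B = iter n S nu B.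
  elim: n B => [//|n IH] B mB.
  rewrite csubE -(stochastic_op_csub stochS)//=.
  exact: (stochastic_op_ext mV V1 stochS).
pose v := fine (Vnorm V nu).
have v0 : 0 <= v by rewrite fine_ge0// Vnorm_ge0.
have g0 : 0 < g by case/andP: g01.
have incr n : (Vnorm V (csub (mu n.+1) (mu n)) <= ((C * v) * g ^+ n)%:E)%E.
  rewrite (eq_Vnorm mV V0 (nuE n)); apply: le_trans (H _ nuN nuV n) _.
  by rewrite -(fineK (fin_Vnorm nuV)) -EFinM lee_fin mulrAC.
have Cv0 : 0 <= C * v by rewrite mulr_ge0//; lra.
have [l lmu] : exists l, forall n, (Vnorm V (csub l (mu n)) <=
    \sum_(0 <= k <oo) Vnorm V (csub (mu (n + k).+1) (mu (n + k)%N)))%E.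
  apply: Vnorm_complete => //; apply: le_lt_trans (ltry _).
  by apply: nneseries_le_geometric incr => // n; exact: Vnorm_ge0.
(* The tail from [n] of the geometric series [C * v * g ^+ k] sums to [D * g ^+ n]. *)
pose D := C * v / (1 - g).
have {}lmu n : (Vnorm V (csub l (mu n)) <= (D * g ^+ n)%:E)%E.
  apply: le_trans (lmu n) _.
  have -> : D * g ^+ n = C * v * g ^+ n / (1 - g) by rewrite /D mulrAC.
  apply: nneseries_le_geometric => //.
  - by rewrite mulr_ge0// exprn_ge0// ltW.
  - by move=> k; exact: Vnorm_ge0.
  - by move=> k; apply: le_trans (incr _) _; rewrite exprD mulrA.
have lB n B : measurable B -> (`|l B - mu n B| <= (D * g ^+ n)%:E)%E.
  move=> mB; rewrite -csubE; apply: le_trans (lmu n).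
  exact: le_trans (abse_le_tvnorm _ mB) (tvnorm_le_Vnorm mV V1 _).
have lmuV n : in_MV V (csub l (mu n)) by exact: le_lt_trans (lmu n) (ltry _).
exists l; split; [split; [split|]|].
(* As [mu n B] is nonnegative, [- l B] is at most the distance from [l B] to [mu n B]. *)
- move=> B mB; rewrite -leeN2 oppe0; apply: (@le0_le_geometric _ D _ _ g01) => n.
  have := lB n _ mB; have := (muP n).1 _ mB.
  have /EFin_fin_numP[s ->] := fin_num_measure l _ mB.
  have /EFin_fin_numP[t ->] := fin_num_measure (mu n) _ mB.
  rewrite -EFinB abse_EFin -EFinN !lee_fin ler_norml => t0 /andP[st _].
  by lra.
- have : (`|l setT - 1| <= 0)%E.
    apply: (@le0_le_geometric _ D _ _ g01) => n.
    by rewrite -(muP n).2; exact: lB.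
  have /EFin_fin_numP[s ->] := fin_num_measure l _ (@measurableT _ T).
  by rewrite lee_fin normr_le0 subr_eq0 => /eqP ->.
(* Compare [S l] and [l] with [mu n.+1]. The first difference is [S] applied to [l - mu n], where
   the Lyapunov bound gives the factor [gammaL + K]; the second contributes [D * g]. *)
- have : (Vnorm V (csub (S l) l) <= 0)%E.
    apply: (@le0_le_geometric _ ((gammaL + K) * D + D * g) _ _ g01) => n.
    have E1 : (Vnorm V (csub (S l) (mu n.+1)) <= ((gammaL + K) * D * g ^+ n)%:E)%E.
      have -> : Vnorm V (csub (S l) (mu n.+1)) = Vnorm V (S (csub l (mu n))).
        apply: eq_Vnorm => // B mB.
        by rewrite csubE (stochastic_op_csub stochS).
      apply: le_trans (lyapunov (lmuV n)) _.
      apply: (@le_trans _ _ ((gammaL + K)%:E * Vnorm V (csub l (mu n)))%E).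
        rewrite EFinD ge0_muleDl ?lee_fin//; last by lra.
        by rewrite leeD2l// lee_wpmul2l// ?lee_fin// tvnorm_le_Vnorm.
      rewrite -mulrA EFinM; apply: lee_wpmul2l; last exact: lmu.
      by rewrite lee_fin addr_ge0// ltW.
    have -> : ((gammaL + K) * D + D * g) * g ^+ n =
        (gammaL + K) * D * g ^+ n + D * g ^+ n.+1 by rewrite exprS; ring.
    rewrite EFinD; apply: le_trans (leeD E1 (lmu n.+1)).
    apply: Vnorm_leD => // B mB; rewrite !csubE.
    have /EFin_fin_numP[s ->] := fin_num_measure l _ mB.
    have /EFin_fin_numP[t ->] := fin_num_measure (S l) _ mB.
    have /EFin_fin_numP[u ->] := fin_num_measure (mu n.+1) _ mB.
    rewrite lee_fin; have -> : t - s = (t - u) - (s - u) by ring.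
    exact: ler_normB.
  move=> /(Vnorm_eq0 mV V1) Sl B mB; have := Sl B mB; rewrite csubE.
  have /EFin_fin_numP[s ->] := fin_num_measure l _ mB.
  have /EFin_fin_numP[t ->] := fin_num_measure (S l) _ mB.
  by move=> [/eqP]; rewrite subr_eq0 => /eqP ->.
- apply: (@le_lt_trans _ _ (Vnorm V (csub l mu0) + Vnorm V mu0)%E).
    apply: Vnorm_leD => // B mB; rewrite csubE.
    have /EFin_fin_numP[s ->] := fin_num_measure l _ mB.
    have /EFin_fin_numP[t ->] := fin_num_measure mu0 _ mB.
    by rewrite lee_fin -{1}(subrK t s) ler_normD.
  by rewrite lte_add_pinfty//; exact: (lmuV 0%N).
Qed.

End lyapunov_coupling.

Theorem theorem3p2 (d : measure_display) (T : measurableType d) (R : realType)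
  (V : T -> R)
  (S : {charge set T -> \bar R} -> {charge set T -> \bar R})
  (gammaL K gammaH A : R) :
  measurable_fun setT V ->
  (forall x, 1 <= V x) ->
  stochastic_op_V V S ->
  0 < gammaL < 1 -> 0 <= K ->
  (forall mu, in_MV V mu ->
     (Vnorm V (S mu) <= gammaL%:E * Vnorm V mu + K%:E * tvnorm mu)%E) ->
  0 < gammaH < 1 -> 0 < A ->
  (forall nu, in_N nu -> in_MV V nu ->
     (Vnorm V nu <= A%:E * tvnorm nu)%E ->
     (tvnorm (S nu) <= gammaH%:E * tvnorm nu)%E) ->
  K / A < 1 - gammaL ->
  (exists mustar, equilibrium S mustar /\ in_MV V mustar /\
     (forall mu, equilibrium S mu -> in_MV V mu ->
        forall B, measurable B -> mu B = mustar B)) /\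
  (exists gamma C : R, 0 < gamma < 1 /\ 1 <= C /\
     forall nu, in_N nu -> in_MV V nu -> forall n : nat,
       (Vnorm V (iter n S nu) <= (C * gamma ^+ n)%:E * Vnorm V nu)%E).
Proof.
move=> mV V1 stochS gL01 K0 lyap gH01 A0 coup KA; split.
  have [mu [muE muV]] :=
    equilibrium_exists mV V1 stochS gL01 K0 lyap gH01 A0 coup KA.
  exists mu; split=> //; split=> // mu' mu'E mu'V.
  exact: (equilibrium_uniq mV V1 stochS gL01 K0 lyap gH01 A0 coup KA).
have [g [C [g01 C1 H]]] :=
  Vnorm_iter_le mV V1 stochS gL01 K0 lyap gH01 A0 coup KA.
by exists g, C.
Qed.
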